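(* For any integer $\theta\ge2$ and any $\tau\in(\theta^{-1},1)$, the Weierstrass function $\{\mathcal{W}_{\tau,\theta}(t), t\in[0,1]\}$, $\mathcal{W}_{\tau,\theta}(t)=\sum_{n=0}^\infty\tau^n\cos(2\pi\theta^n t)$, is non-polar for the real-valued fractional Brownian motion $\{B^H(t), t\in[0,1]\}$ with Hurst index $H\in(0,1)$.
   Context: Real-valued fractional Brownian motion of Hurst index $H\in(0,1)$ is the centered Gaussian process with continuous paths and covariance $\mathbb{E}(B^H(s)B^H(t))=\frac12(|t|^{2H}+|s|^{2H}-|t-s|^{2H})$. A Borel function $f$ is called polar for a process $X$ if for every $x\in\mathbb{R}$, $\mathbb{P}\{X_t+x=f(t)\text{ for some }t>0\}=0$; here, as $f$ and $X$ are considered on $[0,1]$, $t$ ranges over $(0,1]$. The function $f$ is non-polar for $X$ if it is not polar, i.e. if this probability is positive for some $x\in\mathbb{R}$. *)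

(* Defs.v *)
From HB Require Import structures.
From mathcomp Require Import all_boot all_order all_algebra.
From mathcomp Require Import all_classical all_reals all_analysis.

Set Implicit Arguments.
Unset Strict Implicit.
Unset Printing Implicit Defensive.

Import Order.TTheory GRing.Theory Num.Theory.
Import numFieldNormedType.Exports.

Local Open Scope classical_set_scope.
Local Open Scope ring_scope.

(* [normal_prob m 0] is by convention the uniform law on [0, 1], so the
   degenerate Gaussian law N(m, 0) has to be given separately as a Dirac
   mass; it is needed since, e.g., B^H(0) = 0 almost surely. *)
Definition gaussian_law {R : realType} (m s : R) (A : set R) : \bar R :=
  if s == 0 then (\d_m A)%E else normal_prob m s A.

Definition gaussian_rv d (T : measurableType d) (R : realType)
    (P : probability T R) (Y : T -> R) : Prop :=
  exists m s : R, forall A : set R, measurable A ->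
    P (Y @^-1` A) = gaussian_law m s A.

(* The time index is a real number, but only the times in [I] matter. *)
Definition gaussian_process d (T : measurableType d) (R : realType)
    (P : probability T R) (I : set R) (X : R -> {RV P >-> R}) : Prop :=
  forall (n : nat) (a t : 'I_n -> R), (forall i, I (t i)) ->
    gaussian_rv P (fun w => \sum_(i < n) a i * X (t i) w).

Definition fbm_cov {R : realType} (H s t : R) : R :=
  2^-1 * (`|t| `^ (2 * H) + `|s| `^ (2 * H) - `|t - s| `^ (2 * H)).

Record is_fbm d (T : measurableType d) (R : realType) (P : probability T R)
    (H : R) (X : R -> {RV P >-> R}) : Prop := IsFbm {
  fbm_gaussian : gaussian_process `[0, 1] X ;
  fbm_centered : forall t, t \in `[0, 1] -> ('E_P[X t] = 0)%E ;
  fbm_covariance : forall s t, s \in `[0, 1] -> t \in `[0, 1] ->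
    ('E_P[fun w => (X s w * X t w)%R] = (fbm_cov H s t)%:E)%E ;
  fbm_continuous : forall w : T, {within `[0, 1], continuous (X ^~ w)}
}.

Definition hitting_event d (T : measurableType d) (R : realType)
    (P : probability T R) (X : R -> {RV P >-> R}) (f : R -> R) (x : R)
    : set T :=
  [set w | exists2 t : R, t \in `]0, 1] & X t w + x = f t].

(* For a merely Borel [f] the hitting event need not be measurable, so having
   probability zero is understood up to completion of [P]; on measurable events
   [P.-negligible A] is [P A = 0] (lemma [negligibleP]). *)
Definition polar d (T : measurableType d) (R : realType)
    (P : probability T R) (X : R -> {RV P >-> R}) (f : R -> R) : Prop :=
  forall x : R, P.-negligible (hitting_event X f x).

(* Polarity is a notion for Borel functions, whence the first conjunct. *)
Definition nonpolar d (T : measurableType d) (R : realType)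
    (P : probability T R) (X : R -> {RV P >-> R}) (f : R -> R) : Prop :=
  measurable_fun (`[0, 1] : set R) f /\ ~ polar X f.

Definition weierstrass {R : realType} (tau : R) (theta : nat) (t : R) : R :=
  limn (series (fun n : nat => tau ^+ n * cos (2 * pi * theta%:R ^+ n * t))).

(* Main.v *)
Require Import Defs.
From HB Require Import structures.
From mathcomp Require Import all_boot all_order all_algebra.
From mathcomp Require Import all_classical all_reals all_analysis.
From mathcomp Require Import measurable_realfun lra.

Set Implicit Arguments.
Unset Strict Implicit.
Unset Printing Implicit Defensive.

Import Order.TTheory GRing.Theory Num.Theory.
Import numFieldNormedType.Exports.

Local Open Scope classical_set_scope.
Local Open Scope ring_scope.

(** In dimension one every continuous function [f] is non-polar for fractional
Brownian motion [X], and the Weierstrass function is continuous by the M-test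
([weierstrass_continuous]).

If [f] were polar, almost every path of [f - X] would avoid all the rationals,
of which there are only countably many, during the times in ]0, 1]. A continuous
real function which avoids the rationals on an interval is constant there by the
intermediate value theorem, so the increment of [X] between two positive times
would almost surely be the deterministic increment of [f]
([polar_increment_ae]). Since [X] is centered this constant would be 0
([ae_shift_second_moment]), and then [X] would have the same variance at the
times 1/2 and 1, whereas the variance at time [t] is [t `^ (2 * H)]
([fbm_continuous_nonpolar]). *)

(** * Continuity of the Weierstrass function *)

(** The bound is uniform in [u], which is what the M-test needs: one [n] controls
the tails of all the series dominated by [v]. *)
Lemma series_tail_le (R : realType) (u v : R ^nat) n :
  (forall k, `|u k| <= v k) -> cvgn (series v) ->
  `|limn (series u) - series u n| <= limn (series v) - series v n.
Proof.
move=> uv cv.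
have cu : cvgn (series u).
  apply: normed_cvg; apply: (series_le_cvg _ _ uv cv) => k //.
  exact: le_trans (normr_ge0 _) (uv k).
have cuB : `|series u m - series u n| @[m --> \oo] -->
    `|limn (series u) - series u n|.
  by apply: cvg_norm; apply: cvgB => //; exact: cvg_cst.
have cvB : (series v m - series v n) @[m --> \oo] -->
    limn (series v) - series v n.
  by apply: cvgB => //; exact: cvg_cst.
apply: (ler_cvg_to cuB cvB); near=> m.
have nm : (n <= m)%N by near: m; exists n.
rewrite !sub_series nm (le_trans (ler_norm_sum _ _ _))//.
exact: ler_sum.
Unshelve. all: by end_near. Qed.

Lemma weierstrass_M_test (R : realType) (U : topologicalType)
    (f : nat -> U -> R) (M : R ^nat) :
  (forall n, continuous (f n)) -> (forall n x, `|f n x| <= M n) ->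
  cvgn (series M) -> continuous (fun x => limn (series (f ^~ x))).
Proof.
move=> cf fM cM.
apply: (@uniform_limit_continuous U R
  ((fun n x => series (f ^~ x) n) @ \oo)).
  near_simpl; apply: nearW => n; rewrite /series /=.
  elim: n => [|n IH] x; first by under eq_fun do rewrite big_geq//; exact: cvg_cst.
  under eq_fun do rewrite big_nat_recr//=.
  by apply: continuousD; [exact: IH|exact: cf].
move=> Q /uniform_nbhs[E []]; rewrite -entourage_ballE => -[e e0 eE] EQ.
suff : \forall n \near \oo, Q (fun x => series (f ^~ x) n) by [].
near=> n; apply: EQ => x _; apply: eE.
apply: (le_lt_trans (series_tail_le n (fM ^~ x) cM)).
apply: (le_lt_trans (ler_norm _)).
by near: n; move/cvgrPdist_lt : cM; apply.
Unshelve. all: by end_near. Qed.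

Lemma weierstrass_continuous (R : realType) (tau : R) (theta : nat) :
  `|tau| < 1 -> continuous (weierstrass tau theta).
Proof.
move=> tau1; apply: (@weierstrass_M_test R R _ (geometric 1 `|tau|)).
- move=> n x; apply: cvgM; first exact: cvg_cst.
  apply: continuous_comp; last exact: continuous_cos.
  by apply: cvgM; [exact: cvg_cst|exact: cvg_id].
- move=> n x; rewrite /= mul1r normrM normrX ler_piMr// ?exprn_ge0//.
  by rewrite ler_norml cos_geN1 cos_le1.
- by apply: is_cvg_geometric_series; rewrite normr_id.
Qed.

(** * Polar functions and fractional Brownian motion *)

(** Taking means gives [c = 0], so that [X = Y] almost surely. Additivity of the expectation needs [X] to be
integrable, which its finite second moment gives through [|x| <= 1 + x ^ 2]. *)
Lemma ae_shift_second_moment d (T : measurableType d) (R : realType)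
    (P : probability T R) (X Y : {RV P >-> R}) (a b c : R) :
  ('E_P[X] = 0)%E -> ('E_P[Y] = 0)%E ->
  ('E_P[fun w => (X w * X w)%R] = a%:E)%E ->
  ('E_P[fun w => (Y w * Y w)%R] = b%:E)%E ->
  {ae P, forall w, Y w = X w + c} -> a = b.
Proof.
move=> EX EY EXX EYY YX.
have EYXc : ('E_P[Y] = 'E_P[fun w => (X w + c)%R])%E.
  rewrite unlock; apply: ae_eq_integral => //.
  - by apply/measurable_EFinP.
  - by apply/measurable_EFinP; exact: measurable_funD.
  - by apply: filterS YX => w /= -> _.
have X1 : (X : T -> R) \in Lfun P 1.
  apply/Lfun1_integrable.
  apply: (@le_integrable _ _ _ P setT measurableT _
    (EFin \o (fun w => 1 + X w * X w))) => //.
  - by apply/measurable_EFinP.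
  - move=> w _ /=; rewrite lee_fin [leRHS]ger0_norm ?addr_ge0 -?expr2 ?sqr_ge0//.
    rewrite -[in leRHS]real_normK ?num_real//.
    by have := sqr_ge0 (`|X w| - 1); have := normr_ge0 (X w); nra.
  - apply/Lfun1_integrable; apply: rpredD; first exact: Lfun_cst.
    apply/Lfun1_integrable/integrableP; split.
      by apply/measurable_EFinP; exact: measurable_funM.
    rewrite (_ : (fun _ => _) = (fun w => (X w * X w)%:E)).
      by move: EXX; rewrite unlock => ->; exact: ltry.
    by apply/funext => w /=; rewrite ger0_norm// -expr2 sqr_ge0.
have c0 : c = 0.
  have EXc : ('E_P[fun w => (X w + c)%R] = 'E_P[X] + 'E_P[cst c])%E.
    exact: expectationD X1 (Lfun_cst P c 1).
  by move: EYXc; rewrite EXc EX EY add0e expectation_cst => -[].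
apply: EFin_inj; rewrite -EXX -EYY unlock; apply: ae_eq_integral => //.
- by apply/measurable_EFinP; exact: measurable_funM.
- by apply/measurable_EFinP; exact: measurable_funM.
- by apply: filterS YX => w /= ->; rewrite c0 addr0.
Qed.

(** A path with another increment makes [f - X] take different values at [s] and
[t], hence some rational value [q] in between: the path then lies in the
hitting event at level [q], and these countably many events are negligible.
The time [0] is excluded because hitting is only observed at positive times. *)
Lemma polar_increment_ae d (T : measurableType d) (R : realType)
    (P : probability T R) (X : R -> {RV P >-> R}) (f : R -> R) (s t : R) :
  (forall w, {within `[0, 1], continuous (X ^~ w)}) ->
  {within `[0, 1], continuous f} -> polar X f -> 0 < s <= t -> t <= 1 ->
  {ae P, forall w, X t w = X s w + (f t - f s)}.
Proof.
move=> cX cf polX /andP[s0 st] t1.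
(* the hitting events at rational levels, enumerated through the countable
   encoding of the rationals *)
pose F n := if unpickle n is Some q then hitting_event X f (ratr (q : rat))
            else set0.
have F0 : P.-negligible (\bigcup_n F n).
  apply: negligible_bigcup => n; rewrite /F; case: unpickle => [q|].
    exact: polX.
  exact: negligible_set0.
apply: negligibleS F0 => w /= /eqP XtXs.
pose g u := f u - X u w.
have gst : g s != g t.
  by apply: contra XtXs => /eqP; rewrite /g => gst; apply/eqP; lra.
have cg : {within `[s, t], continuous g}.
  apply: (@continuous_subspaceW R R `[s, t] `[0, 1]).
    by apply: subset_itv; rewrite bnd_simp// ltW.
  by move=> u; apply: continuousB; [exact: cf|exact: cX].
have mM : Num.min (g s) (g t) < Num.max (g s) (g t).
  case/lt_total/orP: gst => h; rewrite minElt maxElt ?h//.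
  by rewrite (lt_gtF h).
have [q /[!in_itv]/= /andP[mq qM]] := rat_in_itvoo mM.
have [|u /[!in_itv]/= /andP[su ut] guq] := IVT st cg (v := ratr q).
  by rewrite !ltW.
exists (pickle q); first exact: I.
rewrite /F pickleK; exists u; last by rewrite -guq /g subrKC.
by rewrite in_itv/= (lt_le_trans s0 su) (le_trans ut t1).
Qed.

(** The increment between 1/2 and 1 cannot be almost surely constant, because the
variances there, [(1 / 2) `^ (2 * H)] and 1, differ. *)
Lemma fbm_continuous_nonpolar d (T : measurableType d) (R : realType)
    (P : probability T R) (H : R) (X : R -> {RV P >-> R}) (f : R -> R) :
  0 < H -> is_fbm H X -> {within `[0, 1], continuous f} -> nonpolar X f.
Proof.
move=> H0 [_ X0 XX cX] cf; split.
  exact: subspace_continuous_measurable_fun.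
move=> polX.
have half01 : (2^-1 : R) \in `[0, 1] by rewrite in_itv/=; apply/andP; split; lra.
have one01 : (1 : R) \in `[0, 1] by rewrite in_itv/= ler01 lexx.
have inc : {ae P, forall w, X 1 w = X 2^-1 w + (f 1 - f 2^-1)}.
  by apply: polar_increment_ae => //; apply/andP; split; lra.
have := ae_shift_second_moment (X0 _ half01) (X0 _ one01)
  (XX _ _ half01 half01) (XX _ _ one01 one01) inc.
have var u : fbm_cov H u u = `|u| `^ (2 * H).
  rewrite /fbm_cov subrr normr0 powR0 ?mulf_neq0 ?gt_eqF//; lra.
rewrite !var normr1 powR1 /= => /eqP; apply/negP; rewrite lt_eqF//.
rewrite -[ltRHS](congr1 (fun h => h (2 * H)) (@powR1 R)).
apply: gt0_ltr_powR; rewrite ?nnegrE ?mulr_gt0 ?ger0_norm//; lra.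
Qed.

Theorem proposition3p5 (R : realType) (d : measure_display)
    (T : measurableType d) (P : probability T R)
    (H : R) (hH : 0 < H < 1)
    (BH : R -> {RV P >-> R}) (hBH : is_fbm H BH)
    (theta : nat) (htheta : (2 <= theta)%N)
    (tau : R) (htau : theta%:R^-1 < tau < 1) :
  nonpolar BH (weierstrass tau theta).
Proof.
case/andP: hH => H0 _; case/andP: htau => thtau tau1.
apply: (fbm_continuous_nonpolar H0 hBH).
apply/continuous_subspaceT/weierstrass_continuous.
by rewrite ger0_norm// (le_trans _ (ltW thtau))// invr_ge0.
Qed.
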